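(* Let $F$ be a commutative field of characteristic $\neq 2$ and let $\mathcal{E}$ be a power-associative evolution algebra over $F$ of dimension at most $4$ (and at least $1$). Then $\mathcal{E}$ is isomorphic to one and only one of the following algebras (an entry with parameters being a family, in which the parameters take some admissible values). Each algebra of dimension $n$ is given on a basis $e_1,\ldots,e_n$ with $e_ie_j=0$ for $i\ne j$, and squares $e_i^2$ that are not listed are zero. Dimension 1: $N_{1,1}$: all products zero; $\mathcal{E}_{1,2}$: $e_1^2=e_1$. Dimension 2: $N_{2,1}$: all products zero; $N_{2,2}$: $e_1^2=e_2$; $\mathcal{E}_{2,3}$: $e_1^2=e_1$; $\mathcal{E}_{2,4}$: $e_1^2=e_1$, $e_2^2=e_2$. Dimension 3: $N_{3,1}$: all products zero; $N_{3,2}$: $e_1^2=e_2$; $N_{3,3}(\alpha)$: $e_1^2=e_3$, $e_2^2=\alpha e_3$, with $\alpha\in F^*$; $\mathcal{E}_{3,4}$: $e_1^2=e_1$; $\mathcal{E}_{3,5}$: $e_1^2=e_1$, $e_2^2=e_3$; $\mathcal{E}_{3,6}$: $e_1^2=e_1$, $e_2^2=e_2$; $\mathcal{E}_{3,7}$: $e_1^2=e_1$, $e_2^2=e_2$, $e_3^2=e_3$. Dimension 4: $N_{4,1}$: all products zero; $N_{4,2}$: $e_1^2=e_2$; $N_{4,3}(\alpha)$: $e_1^2=e_3$, $e_2^2=\alpha e_3$, with $\alpha\in F^*$; $N_{4,4}$: $e_1^2=e_2$, $e_3^2=e_4$; $N_{4,5}(\alpha,\beta)$: $e_1^2=e_4$,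 $e_2^2=\alpha e_4$, $e_3^2=\beta e_4$, with $\alpha,\beta\in F^*$; $N_{4,6}$: $e_1^2=e_2+e_3$, $e_2^2=e_4$, $e_3^2=-e_4$; $\mathcal{E}_{4,7}$: $e_1^2=e_1$; $\mathcal{E}_{4,8}$: $e_1^2=e_1$, $e_2^2=e_3$; $\mathcal{E}_{4,9}(\alpha)$: $e_1^2=e_1$, $e_2^2=e_4$, $e_3^2=\alpha e_4$, with $\alpha\in F^*$; $\mathcal{E}_{4,10}$: $e_1^2=e_1$, $e_2^2=e_2$; $\mathcal{E}_{4,11}$: $e_1^2=e_1$, $e_2^2=e_2$, $e_3^2=e_4$; $\mathcal{E}_{4,12}$: $e_1^2=e_1$, $e_2^2=e_2$, $e_3^2=e_3$; $\mathcal{E}_{4,13}$: $e_i^2=e_i$ for $i=1,2,3,4$.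
   Context: An $n$-dimensional (not necessarily associative) algebra $\mathcal{E}$ over $F$ is an evolution algebra if it has a basis $\{e_1,\ldots,e_n\}$ (a natural basis) with $e_ie_j=0$ for all $i\neq j$ (and $e_i^2$ arbitrary); such an algebra is commutative. An algebra is power-associative if the subalgebra generated by each single element is associative. $F^*=F\setminus\{0\}$. *)

(* Defs.v *)
From HB Require Import structures.
From mathcomp Require Import all_boot all_order all_algebra.

Set Implicit Arguments.
Unset Strict Implicit.
Unset Printing Implicit Defensive.

Import GRing.Theory.
Local Open Scope ring_scope.

(* A nonassociative algebra of finite dimension over F is a vectType F with a *)
(* bilinear product; it is neither associative, commutative nor unital.       *)

Section Algebra.
Variables (F : fieldType) (E : vectType F) (mul : {bilinear E -> E -> E}).

Definition evolution_algebra : Prop :=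
  exists2 e : (\dim {:E}).-tuple E,
    basis_of fullv e
    & forall i j : 'I_(\dim {:E}), i != j -> mul (tnth e i) (tnth e j) = 0.

Definition subalgebra (U : {vspace E}) : Prop :=
  forall x y, x \in U -> y \in U -> mul x y \in U.

(* Membership in the intersection of all the subalgebras containing x.        *)
Definition in_generated (x y : E) : Prop :=
  forall U : {vspace E}, subalgebra U -> x \in U -> y \in U.

Definition power_associative : Prop :=
  forall x a b c : E,
    in_generated x a -> in_generated x b -> in_generated x c ->
    mul (mul a b) c = mul a (mul b c).

End Algebra.

Definition isomorphic (F : fieldType) (E E' : vectType F)
    (mul : {bilinear E -> E -> E}) (mul' : {bilinear E' -> E' -> E'}) : Prop :=
  exists2 f : {linear E -> E'},
    bijective f & forall x y, f (mul x y) = mul' (f x) (f y).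

Section ModelAlgebra.
Variables (F : fieldType) (n : nat).

(* e k is the k-th vector of the canonical basis, numbered from 1.            *)
Definition e (k : nat) : 'rV[F]_n := \row_(j < n) (j.+1 == k)%:R.

(* The product of F^n with e i * e j = 0 for i != j, and with the squares     *)
(* e 1 * e 1, e 2 * e 2, ... listed by sq; the squares beyond the end of sq   *)
(* are 0, the default value of nth.                                           *)
Definition model_mul (sq : seq 'rV[F]_n) (x y : 'rV[F]_n) : 'rV[F]_n :=
  \sum_(i < n) (x 0 i * y 0 i) *: sq`_i.

Lemma model_mul_bilinear sq :
  bilinear_for ( *:%R : F -> 'rV[F]_n -> _) ( *:%R : F -> 'rV[F]_n -> _)
    (model_mul sq).
Proof.
by split=> u a x y /=; rewrite /model_mul scaler_sumr -big_split /=;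
  apply: eq_bigr => i _; rewrite !mxE scalerA -scalerDl; congr (_ *: _);
  rewrite ?mulrDl ?mulrDr ?mulrA // (mulrC a) -!mulrA.
Qed.

HB.instance Definition _ sq :=
  bilinear_isBilinear.Build F 'rV[F]_n 'rV[F]_n 'rV[F]_n *:%R *:%R
    (model_mul sq) (model_mul_bilinear sq).

End ModelAlgebra.

Arguments e {F n} k.

Variant entry :=
  | N_1_1 | E_1_2
  | N_2_1 | N_2_2 | E_2_3 | E_2_4
  | N_3_1 | N_3_2 | N_3_3 | E_3_4 | E_3_5 | E_3_6 | E_3_7
  | N_4_1 | N_4_2 | N_4_3 | N_4_4 | N_4_5 | N_4_6
  | E_4_7 | E_4_8 | E_4_9 | E_4_10 | E_4_11 | E_4_12 | E_4_13.

Section Belongs.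
Variables (F : fieldType) (E : vectType F) (mul : {bilinear E -> E -> E}).

Definition iso_model (n : nat) (sq : seq 'rV[F]_n) : Prop :=
  isomorphic mul (model_mul sq).
Arguments iso_model n%_N sq : clear implicits.

(* An algebra belongs to an entry with parameters when it is isomorphic to a  *)
(* member of the family for some admissible values of the parameters.         *)
Definition belongs_to (t : entry) : Prop :=
  match t with
  | N_1_1 => iso_model 1 [::]
  | E_1_2 => iso_model 1 [:: e 1]

  | N_2_1 => iso_model 2 [::]
  | N_2_2 => iso_model 2 [:: e 2]
  | E_2_3 => iso_model 2 [:: e 1]
  | E_2_4 => iso_model 2 [:: e 1; e 2]

  | N_3_1 => iso_model 3 [::]
  | N_3_2 => iso_model 3 [:: e 2]
  | N_3_3 => exists2 a : F, a != 0 & iso_model 3 [:: e 3; a *: e 3]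
  | E_3_4 => iso_model 3 [:: e 1]
  | E_3_5 => iso_model 3 [:: e 1; e 3]
  | E_3_6 => iso_model 3 [:: e 1; e 2]
  | E_3_7 => iso_model 3 [:: e 1; e 2; e 3]

  | N_4_1 => iso_model 4 [::]
  | N_4_2 => iso_model 4 [:: e 2]
  | N_4_3 => exists2 a : F, a != 0 & iso_model 4 [:: e 3; a *: e 3]
  | N_4_4 => iso_model 4 [:: e 2; 0; e 4]
  | N_4_5 => exists a b : F,
      [/\ a != 0, b != 0 & iso_model 4 [:: e 4; a *: e 4; b *: e 4]]
  | N_4_6 => iso_model 4 [:: e 2 + e 3; e 4; - e 4]
  | E_4_7 => iso_model 4 [:: e 1]
  | E_4_8 => iso_model 4 [:: e 1; e 3]
  | E_4_9 => exists2 a : F, a != 0 & iso_model 4 [:: e 1; e 4; a *: e 4]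
  | E_4_10 => iso_model 4 [:: e 1; e 2]
  | E_4_11 => iso_model 4 [:: e 1; e 2; e 4]
  | E_4_12 => iso_model 4 [:: e 1; e 2; e 3]
  | E_4_13 => iso_model 4 [:: e 1; e 2; e 3; e 4]
  end.

End Belongs.

Arguments iso_model {F E} mul n%_N sq.

(* Main.v *)
Require Import Defs.
From HB Require Import structures.
From mathcomp Require Import all_boot all_order all_algebra.
From mathcomp Require Import ring zify.

(* Expanding the fourth powers of x + y and x - y for members x, y of a       *)
(* natural basis shows that, when x x^2 != 0, a multiple of x^2 is an         *)
(* idempotent annihilated by the rest of the basis. Splitting off these       *)
(* idempotents leaves a nil algebra N; there the same identities, with three  *)
(* variables, give N^2 N^2 = 0 and (x^2 y) w = 0 for x, y, w in the basis. In *)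
(* small dimension this leaves only the listed tables. The dimensions of E,   *)
(* of E^2, of the annihilator and of E^2 E^2 distinguish the entries.         *)

Set Implicit Arguments.
Unset Strict Implicit.
Unset Printing Implicit Defensive.

Import GRing.Theory.
Local Open Scope ring_scope.

Section LinearCombination.
Variables (F : fieldType) (E : vectType F).

Definition scalar_form (phi : E -> F) : Prop :=
  (forall v w, phi (v + w) = phi v + phi w) *
  (forall v, phi (- v) = - phi v) *
  (forall k v, phi (k *: v) = k * phi v) *
  (forall v n, phi (v *+ n) = phi v *+ n) * (phi 0 = 0).

Lemma scalar_form_ext (v w : E) :
  (forall phi : E -> F, scalar_form phi -> phi v = phi w) -> v = w.
Proof.
move=> h; rewrite (coord_vbasis (memvf v)) (coord_vbasis (memvf w)).
apply: eq_bigr => i _; rewrite (h (coord (vbasis fullv) i)) //.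
by do !split; move=> *; rewrite ?(linearD, linearN, linearZ, linearMn, linear0).
Qed.

Lemma eq_sub_trans (V : zmodType) (a b c d : V) : c = d -> a - b = c - d -> a = b.
Proof. by move=> -> /eqP; rewrite subrr subr_eq0 => /eqP. Qed.

(* Stated for a bare function: rewriting with the canonical structures of     *)
(* {bilinear E -> E -> E} is much slower.                                     *)
Definition bilinear_product (mul : E -> E -> E) : Prop :=
  (forall u v w, mul (u + v) w = mul u w + mul v w) *
  (forall u v w, mul u (v + w) = mul u v + mul u w) *
  (forall k u v, mul (k *: u) v = k *: mul u v) *
  (forall k u v, mul u (k *: v) = k *: mul u v) *
  (forall u v, mul (- u) v = - mul u v) *
  (forall u v, mul u (- v) = - mul u v) *
  (forall u, mul 0 u = 0) * (forall u, mul u 0 = 0).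

Lemma bilinear_productP (mul : {bilinear E -> E -> E}) : bilinear_product mul.
Proof.
by do !split; move=> *; rewrite ?(linearDl, linearDr, linearZl_LR, linearZr_LR,
  linearNl, linearNr, linear0l, linear0r).
Qed.

End LinearCombination.

(* Linear identities between vectors are checked on scalar forms, where ring  *)
(* applies.                                                                   *)
Ltac vring :=
  let phi := fresh "phi" in let phiE := fresh "phiE" in
  apply: scalar_form_ext => phi phiE; rewrite !phiE; ring.

Section PowerIdentities.
Variables (F : fieldType) (E : vectType F) (mul : E -> E -> E).
Local Notation sq x := (mul x x).
Hypotheses (two_neq0 : 2%:R != 0 :> F) (mulE : bilinear_product mul)
  (mulC : forall x y, mul x y = mul y x)
  (power4 : forall x, mul (sq x) (sq x) = mul x (mul x (sq x)))
  (power5 : forall x, mul (mul x (sq x)) (sq x) = mul x (mul (sq x) (sq x))).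

Section TwoVectors.
Variables (x y : E) (a c d g : F).
Hypotheses (xy0 : mul x y = 0) (xX : mul x (sq x) = a *: sq x)
  (yX : mul y (sq x) = c *: sq y) (xY : mul x (sq y) = d *: sq x)
  (yY : mul y (sq y) = g *: sq y).

Let yx0 : mul y x = 0. Proof. by rewrite mulC. Qed.
Let YX : mul (sq y) (sq x) = mul (sq x) (sq y). Proof. exact: mulC. Qed.

Lemma mul_sq_self : mul (sq x) (sq x) = a ^+ 2 *: sq x.
Proof. by rewrite power4 xX mulE xX scalerA. Qed.

Lemma power4_line t :
  a ^+ 2 *: sq x + (2%:R * t ^+ 2) *: mul (sq x) (sq y) +
     (t ^+ 4 * g ^+ 2) *: sq y =
  ((a + t ^+ 2 * d) * a + (t * c + t ^+ 3 * g) * d) *: sq x +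
  ((a + t ^+ 2 * d) * (t * c) + (t * c + t ^+ 3 * g) * (t * g)) *: sq y.
Proof.
have yy : mul (sq y) (sq y) = g ^+ 2 *: sq y.
  by rewrite power4 yY mulE yY scalerA.
apply: eq_sub_trans (power4 (x + t *: y)) _.
rewrite !(mulE, xy0, yx0, xX, yX, xY, yY, YX, yy, mul_sq_self, scaler0, addr0, add0r).
vring.
Qed.

Lemma mul_sq_sq : mul (sq x) (sq y) *+ 2 = (d * a) *: sq x + (c * g) *: sq y.
Proof.
apply: (scalerI two_neq0).
have := congr2 +%R (power4_line 1) (power4_line (-1)).
move=> /eq_sub_trans; apply; vring.
Qed.

Lemma power4_odd : (c * (a + d)) *: sq y + (d * (c + g)) *: sq x = 0.
Proof.
apply: (scalerI two_neq0).
have := congr2 (fun u v => v - u) (power4_line 1) (power4_line (-1)).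
move=> /eq_sub_trans; apply; vring.
Qed.

Lemma nil_mul_sq : a = 0 -> g = 0 -> mul (sq x) (sq y) = 0.
Proof.
move=> a0 g0; apply: (scalerI two_neq0); rewrite scaler0 scaler_nat mul_sq_sq.
by rewrite a0 g0 !mulr0 !scale0r addr0.
Qed.

Lemma nil_mul_eq0 : a = 0 -> g = 0 -> mul y (sq x) = 0 \/ mul x (sq y) = 0.
Proof.
move=> a0 g0; rewrite yX xY.
have [->|c0] := eqVneq c 0; first by left; rewrite scale0r.
have [->|d0] := eqVneq d 0; first by right; rewrite scale0r.
left; have := power4_odd; rewrite a0 g0 add0r addr0 (mulrC d) -scalerDr.
move/eqP; rewrite scaler_eq0 mulf_eq0 (negPf c0) (negPf d0) /= => /eqP sum0.
have := congr1 (mul y) sum0; rewrite !mulE yY g0 scale0r yX add0r => -> //.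
Qed.

(* With x^2 = x x^2 and y x^2 = c y^2, where c y^2 != 0, the element          *)
(* z = x^2 - 2c y satisfies z^2 = x^2; power-associativity at z gives         *)
(* x^2 y^2 = y^2 and then y^2 = d x^2. Now w = x + c y satisfies              *)
(* w^2 = w x^2 = 2 x^2, so that w^2 w^2 = 4 x^2 while w (w w^2) = 8 x^2.      *)
Lemma idempotent_mul_sq : a = 1 -> mul y (sq x) = 0.
Proof.
move=> a1; rewrite yX; apply/eqP; apply/negPn/negP; rewrite scaler_eq0 negb_or.
case/andP=> c0 Y0.
have XX : mul (sq x) (sq x) = sq x by rewrite mul_sq_self a1 expr1n scale1r.
have Xy : mul (sq x) y = c *: sq y by rewrite mulC.
have Yy : mul (sq y) y = g *: sq y by rewrite mulC.
have zz : sq (sq x - (2%:R * c) *: y) = sq x.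
  by rewrite !(mulE, XX, Xy, yX); vring.
have XY : mul (sq x) (sq y) = sq y.
  have c2 : 2%:R * c ^+ 2 != 0 by rewrite mulf_neq0 ?expf_neq0.
  apply: (scalerI c2); have := power5 (sq x - (2%:R * c) *: y).
  rewrite !zz; rewrite !(mulE, XX, Xy, yX, YX) => /esym/eq_sub_trans; apply; vring.
have cg : c * g = 1.
  have := power4 (sq x - (2%:R * c) *: y).
  rewrite !zz; rewrite !(mulE, XX, Xy, yX, YX, XY, yY) => eqz.
  have : (4%:R * c ^+ 2 * (1 - c * g)) *: sq y = 0.
    by move: eqz => /eq_sub_trans; apply; vring.
  move/eqP; rewrite scaler_eq0 (negPf Y0) orbF !mulf_eq0 (_ : 4 = 2 * 2)%N //.
  rewrite natrM mulf_eq0 (negPf two_neq0) /= (negPf c0) subr_eq0 /=.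
  by move/eqP.
have Yd : sq y = d *: sq x.
  have := mul_sq_sq; rewrite XY cg a1 => /eq_sub_trans; apply; vring.
have d0 : d != 0 by apply: contraNneq Y0 => d0; rewrite Yd d0 scale0r.
have X0 : sq x != 0 by apply: contraNneq Y0 => X0; rewrite Yd X0 scaler0.
have gdc : g = d * c.
  have : (g - d * c) *: sq y = 0.
    have := congr1 (mul y) Yd; rewrite yY mulE yX => /eq_sub_trans; apply; vring.
  by move/eqP; rewrite scaler_eq0 (negPf Y0) orbF subr_eq0 => /eqP.
have dc2 : d * c ^+ 2 = 1 by rewrite -cg gdc; ring.
have wX : mul (x + c *: y) (sq x) = 2%:R *: sq x.
  rewrite !mulE xX yX a1 Yd !scalerA -scalerDl; congr (_ *: _).
  by rewrite -dc2; ring.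
have ww : sq (x + c *: y) = 2%:R *: sq x.
  rewrite !(mulE, xy0, yx0) Yd !scaler0 addr0 add0r.
  by rewrite !scalerA -[X in X + _]scale1r -scalerDl; congr (_ *: _); rewrite -dc2; ring.
have := power4 (x + c *: y); move: (x + _) wX ww => w wX ww.
rewrite ww !(mulE, wX, XX).
move=> /eqP; rewrite !scalerA -subr_eq0 -scalerBl scaler_eq0 (negPf X0) orbF.
have -> : 2%:R * 2%:R - 2%:R * (2%:R * 2%:R) = - (2%:R * 2%:R) :> F by ring.
by rewrite oppr_eq0 mulf_eq0 (negPf two_neq0).
Qed.

End TwoVectors.

Lemma nil_triple x y w :
  mul x y = 0 -> mul x w = 0 -> mul y w = 0 ->
  {in [:: x; y; w], forall u, mul u (sq u) = 0} ->
  {in [:: x; y; w] &, forall u v, mul (sq u) (sq v) = 0} ->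
  {in [:: x; y; w] &, forall u v, mul u (mul v (sq u)) = 0} ->
  {in [:: x; y; w] &, forall u v, mul v (mul v (sq u)) = 0} ->
  mul w (mul y (sq x)) + mul y (mul w (sq x)) = 0.
Proof.
move=> xy xw yw nil sqsq uvu uvv.
have yx : mul y x = 0 by rewrite mulC.
have wx : mul w x = 0 by rewrite mulC.
have wy : mul w y = 0 by rewrite mulC.
have [xT yT wT] : [/\ x \in [:: x; y; w], y \in [:: x; y; w] & w \in [:: x; y; w]].
  by rewrite !inE !eqxx !orbT.
pose simp := (mulE, xy, xw, yw, yx, wx, wy, nil x xT, nil y yT, nil w wT,
  sqsq x x xT xT, sqsq x y xT yT, sqsq x w xT wT,
  sqsq y x yT xT, sqsq y y yT yT, sqsq y w yT wT,
  sqsq w x wT xT, sqsq w y wT yT, sqsq w w wT wT,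
  uvu x y xT yT, uvu x w xT wT, uvu y x yT xT, uvu y w yT wT,
  uvu w x wT xT, uvu w y wT yT, uvv x y xT yT, uvv x w xT wT,
  uvv y x yT xT, uvv y w yT wT, uvv w x wT xT, uvv w y wT yT,
  @addr0 E, @add0r E, @oppr0 E, @opprK E).
apply: (scalerI two_neq0).
have := congr2 +%R (power4 (x + y + w)) (power4 (x - y - w)).
rewrite !simp => /esym/eq_sub_trans; apply; vring.
Qed.

End PowerIdentities.

Section NaturalBases.
Variables (F : fieldType) (E : vectType F) (mul : {bilinear E -> E -> E}).
Local Notation sq x := (mul x x).
Let mulE := bilinear_productP mul.

Definition pairwise_null (l : seq E) : Prop :=
  {in l &, forall x y, x != y -> mul x y = 0}.

Definition natural_basis (l : seq E) : Prop :=
  basis_of fullv l /\ pairwise_null l.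

Lemma natural_uniq l : natural_basis l -> uniq l.
Proof. by case=> /basis_free/free_uniq. Qed.

Lemma natural_span l v : natural_basis l -> v \in <<l>>%VS.
Proof. by case=> /span_basis -> _; apply: memvf. Qed.

Lemma perm_natural l l' : perm_eq l l' -> natural_basis l -> natural_basis l'.
Proof.
move=> pll' [bl ol]; split; first by rewrite -(perm_basis _ pll').
by move=> x y; rewrite -!(perm_mem pll'); apply: ol.
Qed.

Lemma mul_span0 X x v :
  {in X, forall y, mul y x = 0} -> v \in <<X>>%VS -> mul v x = 0.
Proof.
move=> Xx0 vX; have /subvP/(_ v vX): (<<X>> <= lker (linfun (applyr mul x)))%VS.
  by apply/span_subvP => y /Xx0; rewrite memv_ker lfunE /= /applyr => ->.
by rewrite memv_ker lfunE => /eqP.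
Qed.

Lemma natural_mulC l : natural_basis l -> forall x y, mul x y = mul y x.
Proof.
move=> nl; have ext (f g : {linear E -> E}) : {in l, f =1 g} -> f =1 g.
  move=> fg y; have /lfunP/(_ y) : linfun f = linfun g; last by rewrite !lfunE.
  apply/(fullv_lfunP _ _ (span_basis nl.1)) => z zl.
  by rewrite !lfunE; apply: fg.
have lC x : x \in l -> forall y, mul x y = mul y x.
  move=> xl; apply: (ext (mul x) (applyr mul x)) => z zl /=; rewrite /applyr.
  by have [->//|nxz] := eqVneq x z; rewrite !nl.2 // eq_sym.
move=> x; apply: (ext (mul x) (applyr mul x)) => z zl /=.
by rewrite /applyr (lC z zl).
Qed.

Lemma span_consP (x : E) m v :
  v \in <<x :: m>>%VS -> exists c, exists2 r, r \in <<m>>%VS & v = c *: x + r.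
Proof.
by rewrite span_cons => /memv_addP[_ /vlineP[c ->] [r rm ->]]; exists c, r.
Qed.

Lemma pairwise_null_cons x m : uniq (x :: m) -> pairwise_null (x :: m) ->
  {in <<m>>%VS, forall r, mul r x = 0}.
Proof.
case/andP=> xm _ oxm r; apply: mul_span0 => y ym.
by apply: oxm; rewrite ?inE ?ym ?eqxx ?orbT //; apply: contraNneq xm => <-.
Qed.

Lemma pairwise_null_behead x m : pairwise_null (x :: m) -> pairwise_null m.
Proof. by move=> o y z ym zm; apply: o; rewrite inE ?ym ?zm orbT. Qed.

Lemma mul_basis l x v :
  natural_basis l -> x \in l -> exists c, mul v x = c *: sq x.
Proof.
move=> nl xl; have nx := perm_natural (perm_to_rem xl) nl.
have [c [r rm ->]] := span_consP (natural_span v nx).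
exists c; rewrite !mulE (pairwise_null_cons (natural_uniq nx) nx.2 rm).
by rewrite addr0.
Qed.

Lemma span_cat_null s z v :
  uniq (s ++ z) -> pairwise_null (s ++ z) -> {in s, forall x, sq x != 0} ->
  v \in <<s ++ z>>%VS -> {in s, forall x, mul v x = 0} -> v \in <<z>>%VS.
Proof.
elim: s => [|x s ih] //= usz osz sq0 vsz vs0.
have [c [r rm dv]] := span_consP vsz.
have := vs0 x (mem_head _ _); rewrite {1}dv !mulE (pairwise_null_cons usz osz rm) addr0.
move/eqP; rewrite scaler_eq0 (negPf (sq0 _ (mem_head _ _))) orbF => /eqP c0.
move: dv; rewrite c0 scale0r add0r => dv.
apply: ih => [||y ys||y ys]; rewrite ?dv //; first by case/andP: usz.
- exact: pairwise_null_behead osz.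
- by apply: sq0; rewrite inE ys orbT.
- by rewrite -dv vs0 // inE ys orbT.
Qed.

Lemma natural_change_head x u m :
  natural_basis (x :: m) -> x \in <<u :: m>>%VS ->
  {in m, forall y, mul u y = 0 /\ mul y u = 0} -> natural_basis (u :: m).
Proof.
move=> [bxm oxm] xu um0; split.
  have := size_basis (n := (size m).+1) (X := in_tuple (x :: m)) bxm => dimE.
  rewrite basisEdim dimE leqnn andbT -(span_basis bxm) span_cons.
  rewrite subv_add -memvE xu /=.
  by apply: sub_span => y ym; rewrite inE ym orbT.
move=> y z; rewrite !inE => /predU1P[->|ym] /predU1P[->|zm] //.
- by rewrite eqxx.
- by move=> _; case: (um0 z zm).
- by move=> _; case: (um0 y ym).
by apply: oxm; rewrite inE ?ym ?zm orbT.
Qed.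

Hypotheses (two_neq0 : 2%:R != 0 :> F) (mulC : forall x y, mul x y = mul y x)
  (power4 : forall x, mul (sq x) (sq x) = mul x (mul x (sq x)))
  (power5 : forall x, mul (mul x (sq x)) (sq x) = mul x (mul (sq x) (sq x))).

Lemma mul_basis_l l x v :
  natural_basis l -> x \in l -> exists c, mul x v = c *: sq x.
Proof. by rewrite mulC; apply: mul_basis. Qed.

Lemma natural_idempotent x m :
  natural_basis (x :: m) -> mul x (sq x) != 0 ->
  exists2 u, sq u = u & natural_basis (u :: m).
Proof.
move=> nxm xX0; have um := natural_uniq nxm.
have [a xX] := mul_basis_l (sq x) nxm (mem_head _ _).
have [a0 X0] : a != 0 /\ sq x != 0.
  by apply/andP; rewrite -negb_or -scaler_eq0 -xX.
pose y := a^-1 *: x.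
have xy : x = a *: y by rewrite /y scalerA divff ?scale1r.
have nym : natural_basis (y :: m).
  apply: (natural_change_head nxm).
    by rewrite xy memvZ // memv_span // mem_head.
  move=> z zm; have xz : mul x z = 0.
    apply: nxm.2; rewrite ?inE ?eqxx ?zm ?orbT //.
    by case/andP: um => xm _; apply: contraNneq xm => ->.
  by rewrite /y !mulE xz [mul z x]mulC xz scaler0.
have yY : mul y (sq y) = 1 *: sq y.
  by rewrite scale1r /y !mulE xX; do 2!congr (_ *: _); rewrite scalerA mulVf ?scale1r.
have Y0 : sq y != 0.
  by rewrite /y !mulE !scaler_eq0 !invr_eq0 (negPf a0) (negPf X0).
have um' := natural_uniq nym.
clearbody y.
exists (sq y).
  by rewrite power4 !yY !mulE yY !scale1r.
apply: (natural_change_head nym); last first.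
  move=> z zm; rewrite [mul (sq y) z]mulC.
  have yz : mul y z = 0.
    rewrite mulC; apply: pairwise_null_cons um' nym.2 _ _; exact: memv_span.
  have zy : z \in y :: m by rewrite inE zm orbT.
  have [c h1] := mul_basis_l (sq y) nym zy.
  have [d h2] := mul_basis_l (sq z) nym (mem_head _ _).
  have [g h3] := mul_basis_l (sq z) nym zy.
  by rewrite (idempotent_mul_sq two_neq0 mulE mulC power4 power5 yz yY h1 h2 h3).
have [b [r rm dY]] := span_consP (natural_span (sq y) nym).
have b0 : b != 0.
  apply: contraNneq Y0 => b0; rewrite -[sq y]scale1r -yY mulC.
  by rewrite {1}dY b0 scale0r add0r (pairwise_null_cons um' nym.2 rm).
have yE : y = b^-1 *: (sq y - r).
  by rewrite dY addrK scalerA mulVf ?scale1r.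
rewrite [X in X \in _]yE memvZ // memvB //; first by rewrite memv_span // mem_head.
by move: rm; apply/subvP; apply: sub_span => z zm; rewrite inE zm orbT.
Qed.

Lemma idempotent_splitting l :
  natural_basis l -> exists us ns, [/\ natural_basis (us ++ ns),
    {in us, forall u, sq u = u} & {in ns, forall x, mul x (sq x) = 0}].
Proof.
move=> nl; suff /(_ (size l) l [::]) : forall k ns us, (size ns <= k)%N ->
    natural_basis (us ++ ns) -> {in us, forall u, sq u = u} ->
    exists us ns, [/\ natural_basis (us ++ ns),
    {in us, forall u, sq u = u} & {in ns, forall x, mul x (sq x) = 0}].
  by apply.
elim=> [|k ih] ns us sns nn ius.
  by exists us, ns; split=> // x; case: ns sns {nn}.
have [/allP ns0|/allPn[x xns xX0]] := boolP (all (fun x => mul x (sq x) == 0) ns).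
  by exists us, ns; split=> // x /ns0/eqP.
have pns := perm_to_rem xns.
have pall : perm_eq (us ++ ns) (x :: us ++ rem x ns).
  rewrite perm_sym -[x :: _]/([:: x] ++ us ++ rem x ns) perm_catCA perm_cat2l.
  by rewrite perm_sym.
have [u uu nu] := natural_idempotent (perm_natural pall nn) xX0.
apply: (ih (rem x ns) (u :: us)) => //.
  by move: sns; rewrite (perm_size pns).
by move=> v; rewrite inE => /predU1P[->|/ius].
Qed.

Section NilPart.
Variables us ns : seq E.
Hypotheses (nb : natural_basis (us ++ ns)) (us_idem : {in us, forall u, sq u = u})
  (ns_nil : {in ns, forall x, mul x (sq x) = 0}).

Let ns_mem x : x \in ns -> x \in us ++ ns.
Proof. by rewrite mem_cat orbC => ->. Qed.

Let us_mem x : x \in us -> x \in us ++ ns.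
Proof. by rewrite mem_cat => ->. Qed.

Lemma nil_basis_mul0 : {in ns &, forall x y, x != y -> mul x y = 0}.
Proof. by move=> x y /ns_mem xns /ns_mem yns; apply: nb.2. Qed.

Lemma nil_sq_mul_sq : {in ns &, forall x y, mul (sq x) (sq y) = 0}.
Proof.
move=> x y xn yn; have [<-|nxy] := eqVneq x y.
  by rewrite power4 (ns_nil xn) mulE.
have [c h1] := mul_basis_l (sq x) nb (ns_mem yn).
have [d h2] := mul_basis_l (sq y) nb (ns_mem xn).
have nil z : z \in ns -> mul z (sq z) = 0 *: sq z by move/ns_nil->; rewrite scale0r.
by apply: (nil_mul_sq two_neq0 mulE mulC power4 (nil_basis_mul0 xn yn nxy)
  (nil x xn) h1 h2 (nil y yn)).
Qed.

Lemma nil_mul_sq_eq0 :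
  {in ns &, forall x y, mul y (sq x) = 0 \/ mul x (sq y) = 0}.
Proof.
move=> x y xn yn; have [<-|nxy] := eqVneq x y; first by left; apply: ns_nil.
have [c h1] := mul_basis_l (sq x) nb (ns_mem yn).
have [d h2] := mul_basis_l (sq y) nb (ns_mem xn).
have nil z : z \in ns -> mul z (sq z) = 0 *: sq z by move/ns_nil->; rewrite scale0r.
by apply: (nil_mul_eq0 two_neq0 mulE mulC power4 (nil_basis_mul0 xn yn nxy)
  (nil x xn) h1 h2 (nil y yn)).
Qed.

Lemma nil_path x y w :
  x \in ns -> y \in ns -> w \in ns -> mul w (mul y (sq x)) = 0.
Proof.
have pathE u v t : v \in ns -> mul t (sq v) = 0 -> mul t (mul v (sq u)) = 0.
  move=> vn tv; have [c ->] := mul_basis_l (sq u) nb (ns_mem vn).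
  by rewrite mulE tv scaler0.
have back u v : u \in ns -> v \in ns -> mul u (mul v (sq u)) = 0.
  move=> un vn; case: (nil_mul_sq_eq0 un vn) => [->|]; first by rewrite mulE.
  exact: pathE.
have stay u v : v \in ns -> mul v (mul v (sq u)) = 0.
  by move=> vn; apply: pathE => //; apply: ns_nil.
move=> xn yn wn.
have [<-|nxy] := eqVneq x y; first by rewrite ns_nil ?mulE.
have [<-|nyw] := eqVneq y w; first exact: stay.
have [<-|nxw] := eqVneq x w; first exact: back.
case: (nil_mul_sq_eq0 yn wn) => [|yW]; first exact: pathE.
have sub : {subset [:: x; y; w] <= ns}.
  by move=> z; rewrite !inE => /or3P[] /eqP->.
have := @nil_triple F E mul two_neq0 mulE mulC power4 x y w
  (nil_basis_mul0 xn yn nxy) (nil_basis_mul0 xn wn nxw) (nil_basis_mul0 yn wn nyw).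
rewrite (pathE x w y wn yW) addr0; apply=>
  [u /sub|u v /sub un /sub vn|u v /sub un /sub vn|u v /sub un /sub vn].
- exact: ns_nil.
- exact: nil_sq_mul_sq.
- exact: back.
- exact: stay.
Qed.

Lemma nil_sq_span x : x \in ns -> sq x \in <<ns>>%VS.
Proof.
move=> xn; apply: (@span_cat_null us) => //.
- exact: natural_uniq nb.
- exact: nb.2.
- move=> u uu; rewrite us_idem //.
  by have /(free_not0 (basis_free nb.1)) := us_mem uu.
- exact: natural_span.
move=> u uu; have uX : mul u (sq u) = 1 *: sq u.
  by rewrite us_idem // us_idem // scale1r.
have ux : mul u x = 0.
  apply: nb.2 (us_mem uu) (ns_mem xn) _; have := natural_uniq nb.
  rewrite cat_uniq => /and3P[_ /hasPn/(_ x xn) /= xu _].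
  by apply: contraNneq xu => <-.
have xU : mul x (sq u) = 0 *: sq x by rewrite us_idem // mulC ux scale0r.
have xX : mul x (sq x) = 0 *: sq x by rewrite ns_nil // scale0r.
have [d h] := mul_basis_l (sq x) nb (us_mem uu).
have := mul_sq_sq two_neq0 mulE mulC power4 ux uX xU h xX.
rewrite mul0r scale0r addr0 mulr1 -h (us_idem uu) => /eqP.
by rewrite mulr2n -subr_eq0 addrK mulC => /eqP.
Qed.

End NilPart.

End NaturalBases.

Section Coordinates.
Variables (F : fieldType) (E : vectType F) (n : nat) (l : seq E).

Definition comb (v : 'rV[F]_n) : E := \sum_(i < n) v 0 i *: l`_i.

Lemma comb_is_linear : linear comb.
Proof.
move=> k u v; rewrite /comb scaler_sumr -big_split; apply: eq_bigr => i _ /=.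
by rewrite !mxE scalerDl scalerA.
Qed.

HB.instance Definition _ :=
  GRing.isLinear.Build F 'rV[F]_n E *:%R comb comb_is_linear.

Lemma comb_e k : (k < n)%N -> comb (e k.+1) = l`_k.
Proof.
move=> kn; rewrite /comb (bigD1 (Ordinal kn)) //= mxE eqxx scale1r.
rewrite big1 ?addr0 // => j jk; rewrite mxE eqSS.
by rewrite (_ : (j == k :> nat) = false) ?scale0r //; apply: negbTE.
Qed.

Definition coords (v : E) : 'rV[F]_n :=
  if size l == n =P true is ReflectT ln then \row_i coord (Tuple ln) i v else 0.

Lemma coords_is_linear : linear coords.
Proof.
move=> k u v; rewrite /coords; case: eqP => [ln|_]; last by rewrite scaler0 addr0.
by apply/rowP => i; rewrite !mxE linearP.
Qed.

HB.instance Definition _ :=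
  GRing.isLinear.Build F E 'rV[F]_n *:%R coords coords_is_linear.

Hypotheses (bl : basis_of fullv l) (sl : size l == n).

Lemma coordsK : cancel coords comb.
Proof.
move=> v; rewrite /coords; case: eqP => // ln.
rewrite [RHS](coord_basis (X := Tuple ln) bl (memvf v)).
by apply: eq_bigr => i _; rewrite mxE.
Qed.

Lemma combK : cancel comb coords.
Proof.
move=> v; rewrite /coords; case: eqP => // ln; apply/rowP => i; rewrite mxE.
by rewrite (coord_sum_free (X := Tuple ln)) // (basis_free bl).
Qed.

End Coordinates.

Lemma iso_model_natural (F : fieldType) (E : vectType F)
    (mul : {bilinear E -> E -> E}) (n : nat) (sq : seq 'rV[F]_n) (l : seq E) :
  natural_basis mul l -> size l = n ->
  (forall i, (i < n)%N -> mul l`_i l`_i = comb l sq`_i) -> iso_model mul n sq.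
Proof.
move=> [bl ol] /eqP sl sqE.
exists (coords n l : {linear E -> 'rV[F]_n}).
  by exists (comb (n := n) l); [apply: coordsK | apply: combK].
move=> x y; apply: (can_inj (combK bl sl)); rewrite coordsK //.
rewrite /model_mul linear_sum /=.
have dE v : v = \sum_(i < n) coords n l v 0 i *: l`_i by rewrite -[LHS](coordsK bl sl).
rewrite {1}[x]dE {1}[y]dE linear_sumlz.
apply: eq_bigr => i _; rewrite linear_sumr (bigD1 i) //= big1 => [|j ji].
  by rewrite addr0 linearZl_LR linearZr_LR /= scalerA linearZ /= -sqE.
rewrite linearZl_LR linearZr_LR /= ol ?scaler0 // ?mem_nth ?(eqP sl) //.
by rewrite nth_uniq ?(eqP sl) ?(free_uniq (basis_free bl)) // eq_sym.
Qed.

Section NilClassification.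
Variables (F : fieldType) (E : vectType F) (mul : {bilinear E -> E -> E}).
Local Notation sq x := (mul x x).
Let mulE := bilinear_productP mul.
Hypotheses (two_neq0 : 2%:R != 0 :> F) (mulC : forall x y, mul x y = mul y x)
  (power4 : forall x, mul (sq x) (sq x) = mul x (mul x (sq x)))
  (power5 : forall x, mul (mul x (sq x)) (sq x) = mul x (mul (sq x) (sq x))).

Definition split_basis (us ss zs : seq E) : Prop :=
  [/\ natural_basis mul (us ++ ss ++ zs), {in us, forall u, sq u = u},
      {in ss, forall x, sq x != 0 /\ mul x (sq x) = 0}
    & {in zs, forall z v, mul v z = 0}].

Lemma perm_split us ss ss' zs :
  perm_eq ss ss' -> split_basis us ss zs -> split_basis us ss' zs.
Proof.
move=> pss [nb iu ns nz]; split=> // [|x].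
  by apply: perm_natural nb; rewrite perm_cat2l perm_cat2r.
by rewrite -(perm_mem pss); apply: ns.
Qed.

Lemma split_basis_exists l :
  natural_basis mul l -> exists us ss zs, split_basis us ss zs.
Proof.
move=> nl; have [us [ns [nb iu nn]]] :=
  idempotent_splitting two_neq0 mulC power4 power5 nl.
have ptl : perm_eq (us ++ ns)
    (us ++ [seq x <- ns | sq x != 0] ++ [seq x <- ns | sq x == 0]).
  rewrite perm_cat2l perm_sym perm_catC.
  by rewrite (permEl (perm_filterC (fun x => sq x == 0) ns)).
exists us, [seq x <- ns | sq x != 0], [seq x <- ns | sq x == 0].
have nb' := perm_natural ptl nb.
split=> // [x|z]; rewrite mem_filter => /andP[x0 xn]; first by rewrite nn.
move=> v; have [|c ->] := mul_basis (x := z) v nb'.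
  by rewrite !mem_cat !mem_filter x0 xn !orbT.
by rewrite (eqP x0) scaler0.
Qed.

Lemma annihilator_span zs :
  {in zs, forall z v, mul v z = 0} -> {in <<zs>>%VS, forall z v, mul v z = 0}.
Proof. by move=> nz z zz v; rewrite mulC; apply: mul_span0 zz => y /nz; rewrite mulC. Qed.

Lemma split_change_tail us ss zs zs' :
  split_basis us ss zs -> <<zs'>>%VS = <<zs>>%VS -> size zs' = size zs ->
  split_basis us ss zs'.
Proof.
move=> [[bl ol] iu ns nz] eqz sz.
have nz' : {in zs', forall z v, mul v z = 0}.
  by move=> z zz; apply: (annihilator_span nz); rewrite -eqz memv_span.
split=> //; split.
  have /eqP dimE := size_basis (X := in_tuple (us ++ ss ++ zs)) bl.
  rewrite basisEdim (eqP dimE) !size_cat sz leqnn andbT -(span_basis bl).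
  by rewrite !span_cat eqz subvv.
have ol' : {in us ++ ss &, forall x y, x != y -> mul x y = 0}.
  by move=> x y xm ym; apply: ol; rewrite catA mem_cat ?xm ?ym.
move=> x y; rewrite catA [x \in _]mem_cat [y \in _]mem_cat.
case/orP=> [xm|/nz' xz]; last by move=> _ _; rewrite mulC xz.
by case/orP=> [ym|/nz' yz]; [apply: ol' | rewrite yz].
Qed.

Lemma split_exchange us ss zs v :
  split_basis us ss zs -> v \in <<zs>>%VS -> v != 0 ->
  exists zs', size zs = (size zs').+1 /\ split_basis us ss (v :: zs').
Proof.
move=> sb vz v0; pose W := (<<zs>> :\: <[v]>)%VS.
have fz : free zs by case: sb => -[/basis_free]; rewrite catA => /catr_free.
have eqz : (<<v :: vbasis W>> = <<zs>>)%VS.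
  rewrite span_cons (span_basis (vbasisP W)) addvC addv_diff.
  by apply/addv_idPl; rewrite -memvE.
have dW : size zs = (\dim W).+1.
  rewrite -(eqP fz) -(dimv_cap_compl <<zs>> <[v]>) (capv_idPr _) -?memvE //.
  by rewrite dim_vline v0.
exists (vbasis W); rewrite size_tuple; split=> //.
by apply: (split_change_tail sb eqz); rewrite /= size_tuple.
Qed.

Section Nil.
Variables us ss zs : seq E.
Hypothesis sb : split_basis us ss zs.

Let ss_mem x : x \in ss -> x \in ss ++ zs.
Proof. by rewrite mem_cat => ->. Qed.

Let nb : natural_basis mul (us ++ ss ++ zs). Proof. by case: sb. Qed.

Let us_idem : {in us, forall u, sq u = u}. Proof. by case: sb. Qed.

Let ns_nil : {in ss ++ zs, forall x, mul x (sq x) = 0}.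
Proof.
case: sb => _ _ ns nz x; rewrite mem_cat => /orP[/ns[]//|xz].
by rewrite [sq x](nz x xz) mulE.
Qed.

Lemma split_path x y w :
  x \in ss -> y \in ss -> w \in ss -> mul w (mul y (sq x)) = 0.
Proof.
move=> /ss_mem xn /ss_mem yn /ss_mem wn.
exact: (nil_path two_neq0 mulC power4 nb ns_nil xn yn wn).
Qed.

Lemma split_sq_sq : {in ss &, forall x y, mul (sq x) (sq y) = 0}.
Proof.
move=> x y /ss_mem xn /ss_mem yn.
exact: (nil_sq_mul_sq two_neq0 mulC power4 nb ns_nil xn yn).
Qed.

Lemma split_sq_span x : x \in ss -> sq x \in <<ss ++ zs>>%VS.
Proof.
by move=> /ss_mem xn; apply: (nil_sq_span two_neq0 mulC power4 nb us_idem ns_nil).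
Qed.

Lemma split_uniq : uniq (ss ++ zs).
Proof. by have := natural_uniq nb; rewrite cat_uniq => /and3P[]. Qed.

Lemma split_null : pairwise_null mul (ss ++ zs).
Proof. by move=> x y xs ys; apply: nb.2; rewrite mem_cat ?xs ?ys orbT. Qed.

Lemma split_sq_tail x :
  x \in ss -> {in ss, forall y, mul y (sq x) = 0} -> sq x \in <<zs>>%VS.
Proof.
move=> xs h; apply: (@span_cat_null _ _ mul ss).
- exact: split_uniq.
- exact: split_null.
- by case: sb => _ _ ns _ y /ns[].
- exact: split_sq_span.
- by move=> y /h; rewrite mulC.
Qed.

Lemma split_edge_target x y :
  x \in ss -> y \in ss -> mul y (sq x) != 0 -> sq y \in <<zs>>%VS.
Proof.
move=> xs ys xy0; apply: split_sq_tail => // w ws.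
have ym : y \in us ++ ss ++ zs by rewrite !mem_cat ys orbT.
have [c yX] := mul_basis_l mulC (sq x) nb ym.
have := split_path xs ys ws; rewrite yX mulE => /eqP; rewrite scaler_eq0.
case/orP => [/eqP c0|/eqP //].
by move: xy0; rewrite yX c0 scale0r eqxx.
Qed.

Lemma split_tail_neq0 x : x \in ss -> (0 < size zs)%N.
Proof.
move=> xs; rewrite lt0n size_eq0; apply/eqP => z0.
have no y : y \in ss -> sq y \in <<zs>>%VS -> False.
  by case: sb => _ _ ns _ /ns[y0 _]; rewrite z0 span_nil memv0 (negPf y0).
have [/allP h|/allPn[y ys h]] := boolP (all (fun y => mul y (sq x) == 0) ss).
  by apply: (no x xs); apply: split_sq_tail => // y /h/eqP.
exact: no ys (split_edge_target xs ys h).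
Qed.

Lemma split_sq_decomposition x ss' :
  x \in ss -> perm_eq ss (x :: ss') ->
  exists2 s, s \in <<ss'>>%VS & exists2 r, r \in <<zs>>%VS & sq x = s + r.
Proof.
move=> xs ps; have [_ _ ns _] := perm_split ps sb.
have := split_sq_span xs.
rewrite (eq_span (Y := x :: ss' ++ zs)); last first.
  by move=> y; rewrite mem_cat (perm_mem ps) -mem_cat.
case/span_consP=> c [v vm dX]; have [X0 xX] := ns x (mem_head _ _).
have ps' : perm_eq (ss ++ zs) (x :: ss' ++ zs) by rewrite -cat_cons perm_cat2r.
have uxm : uniq (x :: ss' ++ zs) by rewrite -(perm_uniq ps') split_uniq.
have oxm : pairwise_null mul (x :: ss' ++ zs).
  by move=> y z; rewrite -!(perm_mem ps'); apply: split_null.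
have c0 : c = 0.
  move: xX; rewrite mulC dX !mulE (pairwise_null_cons uxm oxm vm) addr0 => /eqP.
  by rewrite scaler_eq0 (negPf X0) orbF => /eqP.
move: vm; rewrite span_cat => /memv_addP[s ss'v [r rz dv]].
by exists s => //; exists r => //; rewrite dX c0 scale0r add0r.
Qed.

End Nil.
End NilClassification.

Ltac mem_explicit := by rewrite !inE eqxx ?orbT.

Ltac natural_iso l nl us_idem zs_null :=
  apply: (@iso_model_natural _ _ _ _ _ l nl erefl);
  (do 4?[case=> //=]) => *;
  rewrite ?(linearD, linearN, linearZ, linear0) /= ?comb_e //=;
  first [ by [] | by rewrite us_idem //; mem_explicit
        | by rewrite zs_null //; mem_explicit ].

Section Existence.
Variables (F : fieldType) (E : vectType F) (mul : {bilinear E -> E -> E}).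
Local Notation sq x := (mul x x).
Let mulE := bilinear_productP mul.
Hypotheses (two_neq0 : 2%:R != 0 :> F) (mulC : forall x y, mul x y = mul y x)
  (power4 : forall x, mul (sq x) (sq x) = mul x (mul x (sq x)))
  (power5 : forall x, mul (mul x (sq x)) (sq x) = mul x (mul (sq x) (sq x))).

Lemma belongs_rank0 us zs :
  split_basis mul us [::] zs -> (0 < size us + size zs <= 4)%N ->
  exists t, belongs_to mul t.
Proof.
case=> + iu _ nz.
case: us iu => [|u1 [|u2 [|u3 [|u4 [|]]]]] iu;
  case: zs nz => [|z1 [|z2 [|z3 [|z4 [|]]]]] nz //= nb _.
- by exists N_1_1; natural_iso [:: z1] nb iu nz.
- by exists N_2_1; natural_iso [:: z1; z2] nb iu nz.
- by exists N_3_1; natural_iso [:: z1; z2; z3] nb iu nz.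
- by exists N_4_1; natural_iso [:: z1; z2; z3; z4] nb iu nz.
- by exists E_1_2; natural_iso [:: u1] nb iu nz.
- by exists E_2_3; natural_iso [:: u1; z1] nb iu nz.
- by exists E_3_4; natural_iso [:: u1; z1; z2] nb iu nz.
- by exists E_4_7; natural_iso [:: u1; z1; z2; z3] nb iu nz.
- by exists E_2_4; natural_iso [:: u1; u2] nb iu nz.
- by exists E_3_6; natural_iso [:: u1; u2; z1] nb iu nz.
- by exists E_4_10; natural_iso [:: u1; u2; z1; z2] nb iu nz.
- by exists E_3_7; natural_iso [:: u1; u2; u3] nb iu nz.
- by exists E_4_12; natural_iso [:: u1; u2; u3; z1] nb iu nz.
- by exists E_4_13; natural_iso [:: u1; u2; u3; u4] nb iu nz.
Qed.

Lemma belongs_rank1 us x zs :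
  split_basis mul us [:: x] (sq x :: zs) -> (size us + size zs <= 2)%N ->
  exists t, belongs_to mul t.
Proof.
case=> + iu _ nz.
case: us iu => [|u1 [|u2 [|]]] iu; case: zs nz => [|z1 [|z2 [|]]] nz //= nb _.
- by exists N_2_2; natural_iso [:: x; sq x] nb iu nz.
- by exists N_3_2; natural_iso [:: x; sq x; z1] nb iu nz.
- by exists N_4_2; natural_iso [:: x; sq x; z1; z2] nb iu nz.
- by exists E_3_5; natural_iso [:: u1; x; sq x] nb iu nz.
- by exists E_4_8; natural_iso [:: u1; x; sq x; z1] nb iu nz.
- by exists E_4_11; natural_iso [:: u1; u2; x; sq x] nb iu nz.
Qed.

Lemma belongs_rank2 us x y zs a :
  split_basis mul us [:: x; y] (sq x :: zs) -> sq y = a *: sq x ->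
  (size us + size zs <= 1)%N -> exists t, belongs_to mul t.
Proof.
case=> + iu ns nz dY.
have a0 : a != 0.
  have [|+ _] := ns y; first by rewrite !inE eqxx orbT.
  by apply: contraNneq => a0; rewrite dY a0 scale0r.
case: us iu => [|u1 [|]] iu; case: zs nz => [|z1 [|]] nz //= nb _.
- by exists N_3_3; exists a => //; natural_iso [:: x; y; sq x] nb iu nz.
- by exists N_4_3; exists a => //; natural_iso [:: x; y; sq x; z1] nb iu nz.
- by exists E_4_9; exists a => //; natural_iso [:: u1; x; y; sq x] nb iu nz.
Qed.

Lemma belongs_N44 x y :
  split_basis mul [::] [:: x; y] [:: sq x; sq y] -> exists t, belongs_to mul t.
Proof.
case=> nb iu ns nz.
have nb' : natural_basis mul [:: x; sq x; y; sq y].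
  apply: perm_natural nb; rewrite /= perm_cons.
  by rewrite (perm_catCA [:: y] [:: sq x] [:: sq y]).
by exists N_4_4; natural_iso [:: x; sq x; y; sq y] nb' iu nz.
Qed.

Lemma belongs_N45 x y w a b :
  split_basis mul [::] [:: x; y; w] [:: sq x] -> sq y = a *: sq x ->
  sq w = b *: sq x -> exists t, belongs_to mul t.
Proof.
case=> nb iu ns nz dY dW.
have [|Y0 _] := ns y; first by rewrite !inE eqxx orbT.
have [|W0 _] := ns w; first by rewrite !inE eqxx !orbT.
exists N_4_5; exists a, b; split.
- by apply: contraNneq Y0 => a0; rewrite dY a0 scale0r.
- by apply: contraNneq W0 => b0; rewrite dW b0 scale0r.
by natural_iso [:: x; y; w; sq x] nb iu nz.
Qed.

Lemma belongs_N46 p q r z :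
  split_basis mul [::] [:: p; q; r] [:: z] -> mul q (sq p) != 0 ->
  exists t, belongs_to mul t.
Proof.
move=> sb qP0.
have pT : p \in [:: p; q; r] by rewrite !inE eqxx.
have qT : q \in [:: p; q; r] by rewrite !inE eqxx orbT.
have rT : r \in [:: p; q; r] by rewrite !inE eqxx !orbT.
have Qz := split_edge_target two_neq0 mulC power4 sb pT qT qP0.
have [s sqr [t tz dP]] := split_sq_decomposition two_neq0 mulC power4 sb pT (perm_refl _).
have [c [v + ds]] := span_consP sqr.
rewrite span_seq1 => /vlineP[d dv]; rewrite {v}dv in ds.
have [nb iu ns nz] := sb; have nt := annihilator_span mulC nz tz.
have uniq4 := natural_uniq nb.
have null x y : x \in [:: p; q; r; z] -> y \in [:: p; q; r; z] -> x != y ->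
  mul x y = 0 := nb.2 x y.
have [pq pr qr] : [/\ mul p q = 0, mul p r = 0 & mul q r = 0].
  move: uniq4; rewrite /= !inE !negb_or => /andP[/and3P[npq npr _] /andP[/andP[nqr _] _]].
  by split; apply: null; rewrite // !inE eqxx ?orbT.
have [qp rp rq] : [/\ mul q p = 0, mul r p = 0 & mul r q = 0] by split; rewrite mulC.
have [[P0 pP] [Q0 qQ] [R0 rR]] := And3 (ns p pT) (ns q qT) (ns r rT).
have tn v : mul t v = 0 by rewrite mulC nt.
have qP : mul q (sq p) = c *: sq q by rewrite dP ds !(mulE, nt, qr) scaler0 !addr0.
have c0 : c != 0 by apply: contraNneq qP0 => c0; rewrite qP c0 scale0r.
have rP : mul r (sq p) = d *: sq r by rewrite dP ds !(mulE, nt, rq) scaler0 add0r addr0.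
have PP : c ^+ 2 *: sq q + d ^+ 2 *: sq r = 0.
  have := split_sq_sq two_neq0 mulC power4 sb pT pT.
  by rewrite {1}dP ds !(mulE, tn, qP, rP) addr0 !scalerA -!expr2.
have d0 : d != 0.
  apply: contraNneq Q0 => d0; move: PP; rewrite d0 expr0n scale0r addr0 => /eqP.
  by rewrite scaler_eq0 expf_eq0 (negPf c0).
pose Z := c ^+ 2 *: sq q.
have Zz : (<<[:: Z]>> = <<[:: z]>>)%VS.
  apply/eqP; rewrite eqEdim !span_seq1 !dim_vline -memvE scaler_eq0 negb_or.
  by rewrite expf_neq0 // Q0 leq_b1 memvZ // -span_seq1.
have nzZ : {in [:: Z], forall z v, mul v z = 0}.
  by move=> v vZ; apply: (annihilator_span mulC nz); rewrite -Zz memv_span.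
have [nbZ _ _ _] := split_change_tail mulC sb Zz erefl.
have nb1 : natural_basis mul ((c *: q + t) :: [:: p; r; Z]).
  apply: (@natural_change_head _ _ _ q).
  - by apply: perm_natural nbZ; rewrite (perm_catCA [:: p] [:: q] [:: r; Z]).
  - rewrite [X in X \in _](_ : q = c^-1 *: ((c *: q + t) - t)); last first.
      by rewrite addrK scalerA mulVf ?scale1r.
    rewrite memvZ // memvB //; first by rewrite memv_span // mem_head.
    have tZ : t \in <<[:: Z]>>%VS by rewrite Zz.
    apply: (subvP _ t tZ); apply: sub_span => v; rewrite !inE => ->.
    by rewrite !orbT.
  move=> y; rewrite [mul y _]mulC => yT; suff -> : mul (c *: q + t) y = 0 by [].
  rewrite !mulE tn addr0; suff -> : mul q y = 0 by rewrite scaler0.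
  by move: yT; rewrite !inE => /or3P[] /eqP -> //; rewrite nzZ ?mem_head.
have nb2 : natural_basis mul ((d *: r) :: [:: p; c *: q + t; Z]).
  apply: (@natural_change_head _ _ _ r).
  - apply: perm_natural nb1.
    rewrite (perm_catCA [:: c *: q + t; p] [:: r] [:: Z]) perm_cons.
    by rewrite (perm_catCA [:: c *: q + t] [:: p] [:: Z]).
  - rewrite [X in X \in _](_ : r = d^-1 *: (d *: r)).
      by rewrite memvZ // memv_span // mem_head.
    by rewrite scalerA mulVf ?scale1r.
  move=> y; rewrite [mul y _]mulC => yT; suff -> : mul (d *: r) y = 0 by [].
  rewrite !mulE; suff -> : mul r y = 0 by rewrite scaler0.
  move: yT; rewrite !inE => /or3P[] /eqP -> //; last by rewrite nzZ ?mem_head.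
  by rewrite !mulE rq nt scaler0 addr0.
have nb3 : natural_basis mul [:: p; c *: q + t; d *: r; Z].
  apply: perm_natural nb2.
  by rewrite (perm_catCA [:: d *: r] [:: p; c *: q + t] [:: Z]).
exists N_4_6; apply: (iso_model_natural nb3) => //.
(do 4?[case=> //=]) => _; rewrite ?(linearD, linearN) /= ?comb_e //=.
- by rewrite dP ds -addrA [d *: r + _]addrC addrA.
- by rewrite !(mulE, nt, tn) !addr0 scalerA -expr2.
- by rewrite !mulE scalerA -expr2; apply/eqP; rewrite -addr_eq0 addrC PP.
- by rewrite linear0 nzZ ?mem_head.
Qed.

Lemma split_pair us x y zs :
  split_basis mul us [:: x; y] zs -> mul y (sq x) = 0.
Proof.
move=> sb; have [_ _ _ nz] := sb.
have xT : x \in [:: x; y] by rewrite mem_head.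
have [s] := split_sq_decomposition two_neq0 mulC power4 sb xT (perm_refl _).
rewrite span_seq1 => /vlineP[c ->] [r rz dX].
have [_ _ _ /(annihilator_span mulC)/(_ r rz) nr] := sb.
have yx : mul y x = 0.
  case: sb => nb _ _ _; apply: nb.2; rewrite ?mem_cat ?inE ?eqxx ?orbT //.
  have := natural_uniq nb; rewrite cat_uniq /= inE !negb_or.
  by case/and5P=> _ _ /andP[+ _]; rewrite eq_sym.
have := split_sq_sq two_neq0 mulC power4 sb xT xT.
have yX : mul y (sq x) = c *: sq y by rewrite dX !(mulE, nr) addr0.
rewrite {1}dX !mulE [mul r _]mulC nr addr0 => /eqP; rewrite scaler_eq0.
by case/orP=> [/eqP c0|/eqP //]; rewrite yX c0 scale0r.
Qed.

Lemma belongs_exists l :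
  natural_basis mul l -> (1 <= size l <= 4)%N -> exists t, belongs_to mul t.
Proof.
move=> nl sl; have [us [ss [zs sb]]] := split_basis_exists two_neq0 mulC power4 power5 nl.
have {nl sl} sz : (1 <= size us + (size ss + size zs) <= 4)%N.
  have [nb _ _ _] := sb.
  have /eqP := size_basis (X := in_tuple (us ++ ss ++ zs)) nb.1.
  rewrite (size_basis (X := in_tuple l) nl.1) !size_cat => /eqP <- //.
have tail x : x \in ss -> (0 < size zs)%N.
  exact: (split_tail_neq0 two_neq0 mulC power4 sb).
case: ss => [|x [|y [|w ss]]] in sb sz tail.
- exact: belongs_rank0 sb sz.
- have Xz : sq x \in <<zs>>%VS.
    apply: (split_sq_tail two_neq0 mulC power4 sb); first exact: mem_head.
    move=> y; rewrite inE => /eqP ->.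
    by case: sb => _ _ /(_ x (mem_head _ _))[].
  have [|zs' [szs sb']] := split_exchange mulC sb Xz.
    by case: sb => _ _ /(_ x (mem_head _ _))[].
  by apply: (belongs_rank1 sb'); move: sz; rewrite szs /=; lia.
- have sb2 : split_basis mul us [:: y; x] zs.
    by apply: perm_split sb; rewrite (perm_catC [:: x] [:: y]).
  have [yX xY] := (split_pair sb, split_pair sb2).
  have [_ _ ns nz] := sb.
  have xT : x \in [:: x; y] by rewrite mem_head.
  have yT : y \in [:: x; y] by rewrite !inE eqxx orbT.
  have [[X0 xX] [Y0 yY]] := (ns x xT, ns y yT).
  have Xz : sq x \in <<zs>>%VS.
    apply: (split_sq_tail two_neq0 mulC power4 sb) => // v.
    by rewrite !inE => /orP[] /eqP ->.
  have Yz : sq y \in <<zs>>%VS.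
    apply: (split_sq_tail two_neq0 mulC power4 sb) => // v.
    by rewrite !inE => /orP[] /eqP ->.
  have [/vlineP[a Ya]|indep] := boolP (sq y \in <[sq x]>%VS).
    have [zs' [szs sb']] := split_exchange mulC sb Xz X0.
    by apply: (belongs_rank2 sb' Ya); move: sz; rewrite szs /=; lia.
  have dimXY : \dim <<[:: sq x; sq y]>> = 2%N.
    have : free [:: sq y; sq x] by rewrite free_cons seq1_free X0 span_seq1 indep.
    by rewrite (perm_free (permEl (perm_catC [:: sq y] [:: sq x]))) => /eqP.
  have subXY : (<<[:: sq x; sq y]>> <= <<zs>>)%VS.
    by apply/span_subvP => v; rewrite !inE => /orP[] /eqP ->.
  have zs2 : (2 <= size zs)%N.
    by rewrite -dimXY (leq_trans (dimvS subXY)) // dim_span.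
  have us0 : us = [::] by apply/nilP; rewrite /nilp; move: sz; rewrite /=; lia.
  have szs : size zs = 2%N by move: sz; rewrite us0 /=; lia.
  rewrite us0 in sb; apply: belongs_N44.
  apply: (split_change_tail mulC sb) => //; apply/eqP.
  by rewrite eqEdim subXY dimXY -szs dim_span.
have {}tail := tail x (mem_head _ _).
have us0 : us = [::] by apply/nilP; rewrite /nilp; move: sz; rewrite /=; lia.
have ss0 : ss = [::] by apply/nilP; rewrite /nilp; move: sz; rewrite /=; lia.
have : size zs = 1%N by move: sz; rewrite /=; lia.
case: zs => [|z [|]] // in sb {tail sz} * => _.
rewrite {}us0 {}ss0 in sb.
pose T := [:: x; y; w].
have perm3 p q r : perm_eq T [:: p; q; r] -> split_basis mul [::] [:: p; q; r] [:: z].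
  by move=> pT; apply: perm_split sb.
have [/allP h|/allPn[p pT /allPn[q qT pq]]] :=
    boolP (all (fun p => all (fun q => mul q (sq p) == 0) T) T).
  have Tz v : v \in T -> sq v \in <<[:: z]>>%VS.
    move=> vT; apply: (split_sq_tail two_neq0 mulC power4 sb) => // u uT.
    by apply/eqP; have /allP := h v vT; apply.
  have [xT yT wT] : [/\ x \in T, y \in T & w \in T].
    by rewrite /T !inE !eqxx !orbT.
  have X0 : sq x != 0 by case: sb => _ _ /(_ x xT)[].
  have [zs' [[/esym/size0nil zs0] sb']] := split_exchange mulC sb (Tz x xT) X0.
  rewrite zs0 in sb'.
  have spanX : (<<[:: sq x]>> = <<[:: z]>>)%VS.
    apply/eqP; rewrite eqEdim [X in (X <= _)%VS]span_seq1 -memvE Tz //=.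
    by rewrite (leq_trans (dim_span _)) // span_seq1 dim_vline X0.
  move: (Tz y yT) (Tz w wT); rewrite -spanX span_seq1 => /vlineP[a Ya] /vlineP[b Wb].
  exact: belongs_N45 sb' Ya Wb.
have npq : p != q.
  apply: contraNneq pq => <-; case: sb => _ _ ns _.
  by have [_ ->] := ns p pT.
have [r pqr] : exists r, perm_eq T [:: p; q; r].
  have qT' : q \in rem p T.
    by move: qT; rewrite (perm_mem (perm_to_rem pT)) inE eq_sym (negPf npq).
  have := perm_size (perm_to_rem pT); have := perm_size (perm_to_rem qT').
  case E1 : (rem q (rem p T)) => [|r [|]] //= -> // _; exists r.
  apply: perm_trans (perm_to_rem pT) _; rewrite perm_cons.
  by apply: perm_trans (perm_to_rem qT') _; rewrite E1.
exact: belongs_N46 (perm3 _ _ _ pqr) pq.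
Qed.

End Existence.

Section Signature.
Variables (F : fieldType) (E : vectType F) (mul : {bilinear E -> E -> E}).
Local Notation sq x := (mul x x).

(* For s the squares of a natural basis, these are the dimensions of E, E^2,   *)
(* the annihilator and E^2 E^2.                                               *)
Definition square_signature (m : E -> E -> E) (s : seq E) :
    nat * nat * nat * nat :=
  (size s, \dim <<s>>, count (pred1 (0 : E)) s,
    \dim <<[seq m v w | v <- s, w <- s]>>).

Definition signature (l : seq E) := square_signature mul [seq sq x | x <- l].

Lemma mul_span_mem X Y (W : {vspace E}) u v :
  {in X & Y, forall x y, mul x y \in W} ->
  u \in <<X>>%VS -> v \in <<Y>>%VS -> mul u v \in W.
Proof.
move=> XYW uX vY.
have Xv x : x \in X -> mul x v \in W.
  move=> xX; have /subvP/(_ v vY) : (<<Y>> <= linfun (mul x) @^-1: W)%VS.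
    by apply/span_subvP => y yY; rewrite -memv_preim lfunE; apply: XYW.
  by rewrite -memv_preim lfunE.
have /subvP/(_ u uX) : (<<X>> <= linfun (applyr mul v) @^-1: W)%VS.
  by apply/span_subvP => x xX; rewrite -memv_preim lfunE; apply: Xv.
by rewrite -memv_preim lfunE.
Qed.

Lemma natural_mul_span l u v :
  natural_basis mul l -> mul u v \in <<[seq sq x | x <- l]>>%VS.
Proof.
move=> nl; apply: (mul_span_mem (X := l) (Y := l)); try exact: natural_span nl.
move=> x y xl yl; have [<-|nxy] := eqVneq x y; last by rewrite nl.2 ?mem0v.
by apply/memv_span/mapP; exists x.
Qed.

Lemma natural_annihilator l (v : E) : natural_basis mul l ->
  (v \in <<[seq x <- l | sq x == 0%R]>>%VS) <-> (forall w, mul v w = 0).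
Proof.
move=> nl; have mulC := natural_mulC nl; split=> [vz w|v0].
  apply: mul_span0 vz => z; rewrite mem_filter => /andP[/eqP z0 zl].
  by rewrite mulC; have [c ->] := mul_basis w nl zl; rewrite z0 scaler0.
have pl : perm_eq l ([seq x <- l | sq x != 0] ++ [seq x <- l | sq x == 0]).
  rewrite perm_sym perm_catC.
  by rewrite (permEl (perm_filterC (fun x => sq x == 0) l)).
have nl' := perm_natural pl nl.
apply: (span_cat_null (natural_uniq nl') nl'.2 _ (natural_span v nl')).
  by move=> x; rewrite mem_filter => /andP[].
by move=> x _; apply: v0.
Qed.

Lemma signature_unique l l' :
  natural_basis mul l -> natural_basis mul l' -> signature l = signature l'.
Proof.
move=> nl nl'; have sizeE k : natural_basis mul k -> size k = \dim {:E}.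
  by case=> bk _; rewrite (size_basis (X := in_tuple k) bk).
have sub k k' : natural_basis mul k -> natural_basis mul k' ->
    {subset [seq sq x | x <- k] <= <<[seq sq x | x <- k']>>%VS}.
  by move=> _ nk' _ /mapP[x _ ->]; apply: natural_mul_span.
have sub2 k k' : natural_basis mul k -> natural_basis mul k' ->
    (<<[seq mul v w | v <- [seq sq x | x <- k], w <- [seq sq x | x <- k]]>> <=
     <<[seq mul v w | v <- [seq sq x | x <- k'], w <- [seq sq x | x <- k']]>>)%VS.
  move=> nk nk'; apply/span_subvP => _ /allpairsP[[v w] /= [vk wk ->]].
  apply: mul_span_mem (sub _ _ nk nk' v vk) (sub _ _ nk nk' w wk).
  by move=> x y xk yk; apply/memv_span/allpairsP; exists (x, y).
have countE k : natural_basis mul k ->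
    count (pred1 0) [seq sq x | x <- k] = \dim <<[seq x <- k | sq x == 0%R]>>.
  move=> nk; rewrite count_map -size_filter; apply/esym/eqP.
  exact: filter_free (basis_free nk.1).
rewrite /signature /square_signature !countE // !size_map (sizeE _ nl) (sizeE _ nl').
congr (_, _, _, _).
- by congr (\dim _); apply/eqP; rewrite eqEsubv; apply/andP; split;
    apply/span_subvP; apply: sub.
- congr (\dim _); apply/vspaceP => v.
  by apply/idP/idP => /natural_annihilator h; apply/natural_annihilator; auto.
- by congr (\dim _); apply/eqP; rewrite eqEsubv !sub2.
Qed.

End Signature.

Section Transport.
Variables (F : fieldType) (E E' : vectType F).
Variables (mul : {bilinear E -> E -> E}) (mul' : {bilinear E' -> E' -> E'}).
Variables (f : {linear E -> E'}).
Hypotheses (bij_f : bijective f) (f_mul : forall x y, f (mul x y) = mul' (f x) (f y)).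

Let f_inj : injective f. Proof. exact: bij_inj. Qed.

Let ker_f : lker (linfun f) == 0%VS.
Proof. by apply/lker0P => x y; rewrite !lfunE; apply: f_inj. Qed.

Lemma dim_span_map (X : seq E) : \dim <<map f X>> = \dim <<X>>.
Proof.
rewrite -(limg_dim_eq (f := linfun f)) ?(eqP ker_f) ?capv0 //.
by rewrite limg_span (eq_map (lfunE f)).
Qed.

Lemma natural_of_map l : natural_basis mul' (map f l) -> natural_basis mul l.
Proof.
move=> [bl ol]; split.
  have dimE : \dim {:E} = \dim {:E'}.
    rewrite -(limg_dim_eq (f := linfun f)) ?(eqP ker_f) ?capv0 //.
    congr (\dim _); apply/eqP; rewrite eqEsubv subvf; apply/subvP => y _.
    have [g _ gK] := bij_f; rewrite -(gK y) -(lfunE f); exact: memv_img (memvf _).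
  have sl := size_basis (X := in_tuple (map f l)) bl; rewrite size_map in sl.
  rewrite basisEdim dimE sl leqnn andbT.
  have : <<l>>%VS == fullv by rewrite eqEdim subvf -dim_span_map (span_basis bl) dimE /=.
  by move/eqP->; apply: subvv.
move=> x y xl yl nxy; apply: f_inj; rewrite f_mul linear0.
by apply: ol; rewrite ?map_f // (inj_eq f_inj).
Qed.

Lemma signature_map l : signature mul' (map f l) = signature mul l.
Proof.
have sqE : [seq mul' x x | x <- map f l] = map f [seq mul x x | x <- l].
  by rewrite -!map_comp; apply: eq_map => x /=; rewrite f_mul.
rewrite /signature sqE /square_signature size_map dim_span_map.
move: [seq mul x x | x <- l] => s; congr (_, _, _, _).
  by rewrite count_map; apply: eq_count => x /=; rewrite -(linear0 f) (inj_eq f_inj).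
rewrite -[RHS]dim_span_map; congr (\dim <<_>>).
rewrite map_allpairs allpairs_mapl allpairs_mapr.
by apply: eq_allpairs => u v /=; rewrite f_mul.
Qed.

End Transport.

Section ModelSignature.
Variables (F : fieldType) (n : nat).
Implicit Types (s : seq 'rV[F]_n) (v : 'rV[F]_n).

Definition unit_vectors : seq 'rV[F]_n := [seq e k.+1 | k <- iota 0 n].

Lemma model_mul_e s j k : (j < n)%N -> (k < n)%N ->
  model_mul s (e j.+1) (e k.+1) = if j == k then s`_j else 0.
Proof.
move=> jn kn; rewrite /model_mul (bigD1 (Ordinal jn)) //= !mxE eqxx mul1r eqSS.
rewrite big1 => [|i ij].
  by case: eqP; rewrite ?scale1r ?scale0r addr0.
rewrite mxE eqSS (_ : (i == j :> nat) = false) ?mul0r ?scale0r //.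
exact: negbTE.
Qed.

Lemma unit_vectors_natural s : natural_basis (model_mul s) unit_vectors.
Proof.
split.
  rewrite basisEdim size_map size_iota dimvf dim_matrix.
  rewrite [X in (_ <= X)%N]mul1n leqnn andbT.
  apply/subvP => v _; rewrite [v]row_sum_delta; apply: memv_suml => i _.
  rewrite memvZ // (_ : delta_mx 0 i = e i.+1).
    by apply/memv_span/mapP; exists (val i) => //; rewrite mem_iota /=.
  by apply/rowP => j; rewrite !mxE eqxx /= eqSS.
move=> _ _ /mapP[i + ->] /mapP[j + ->]; rewrite !mem_iota /= => ni nj.
by rewrite model_mul_e //; have [->|//] := eqVneq i j; rewrite eqxx.
Qed.

Lemma signature_unit_vectors s : signature (model_mul s) unit_vectors =
  square_signature (model_mul s) [seq s`_k | k <- iota 0 n].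
Proof.
rewrite /signature /unit_vectors -map_comp; congr (square_signature _ _).
by apply/eq_in_map => k; rewrite mem_iota /= => kn; rewrite /= model_mul_e ?eqxx.
Qed.

Lemma iso_model_signature (E : vectType F) (mul : {bilinear E -> E -> E}) s t :
  (forall m : 'rV[F]_n -> 'rV[F]_n -> 'rV[F]_n, bilinear_product m ->
    (forall j k, (j < n)%N -> (k < n)%N ->
      m (e j.+1) (e k.+1) = if j == k then s`_j else 0) ->
    square_signature m [seq s`_k | k <- iota 0 n] = t) ->
  iso_model mul n s -> exists2 l, natural_basis mul l & signature mul l = t.
Proof.
move/(_ (model_mul s) (bilinear_productP _) (@model_mul_e s)) => <-.
case=> f bij_f f_mul; have [g _ gK] := bij_f.
have fl : map f (map g unit_vectors) = unit_vectors by rewrite (mapK gK).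
exists (map g unit_vectors).
  by apply: (natural_of_map bij_f f_mul); rewrite fl; apply: unit_vectors_natural.
by rewrite -(signature_map bij_f f_mul) fl signature_unit_vectors.
Qed.

Lemma dim_span_pivot k (kn : (k < n)%N) v s :
  v 0 (Ordinal kn) != 0 -> all (fun w : 'rV_n => w 0 (Ordinal kn) == 0) s ->
  \dim <<v :: s>> = (\dim <<s>>).+1.
Proof.
move=> v0 /allP s0; rewrite span_cons dimv_disjoint_sum.
  rewrite dim_vline (_ : v != 0) //.
  by apply: contraNneq v0 => ->; rewrite mxE.
apply/eqP; rewrite -subv0; apply/subvP => w /memv_capP[/vlineP[c ->]].
move=> /(@coord_span _ _ _ (in_tuple s)) cv.
have /matrixP/(_ 0 (Ordinal kn)) := cv.
rewrite summxE big1 => [/eqP|i _]; last first.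
  by rewrite mxE (eqP (s0 _ (mem_nth _ _))) ?mulr0.
by rewrite mxE mulf_eq0 (negPf v0) orbF => /eqP ->; rewrite scale0r mem0v.
Qed.

Lemma dim_span_e k s : (k < n)%N ->
  (forall kn : (k < n)%N, all (fun w : 'rV_n => w 0 (Ordinal kn) == 0) s) ->
  \dim <<e k.+1 :: s>> = (\dim <<s>>).+1.
Proof. by move=> kn s0; apply: dim_span_pivot (s0 kn); rewrite mxE eqxx oner_eq0. Qed.

Lemma dim_span_eD k j s : (k < j < n)%N ->
  (forall kn : (k < n)%N, all (fun w : 'rV_n => w 0 (Ordinal kn) == 0) s) ->
  \dim <<(e k.+1 + e j.+1) :: s>> = (\dim <<s>>).+1.
Proof.
case/andP=> kj jn s0; have kn := ltn_trans kj jn.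
by apply: dim_span_pivot (s0 kn); rewrite !mxE eqxx eqSS (ltn_eqF kj) addr0 oner_eq0.
Qed.

Lemma dim_span0 s : \dim <<(0 : 'rV[F]_n) :: s>> = \dim <<s>>.
Proof. by rewrite span_cons (addv_idPr _) // -memvE mem0v. Qed.

Lemma dim_spanZ a v s : \dim <<v :: a *: v :: s>> = \dim <<v :: s>>.
Proof.
have /addv_idPl sub : (<[a *: v]> <= <[v]>)%VS by rewrite -memvE memvZ ?memv_line.
by rewrite !span_cons addvA sub.
Qed.

Lemma dim_spanN v s : \dim <<v :: - v :: s>> = \dim <<v :: s>>.
Proof. by rewrite -scaleN1r dim_spanZ. Qed.

Lemma e_eq0 k : (k < n)%N -> (e k.+1 == 0 :> 'rV[F]_n) = false.
Proof.
move=> kn; apply/negbTE/eqP => /matrixP/(_ 0 (Ordinal kn)) /eqP.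
by rewrite !mxE eqxx oner_eq0.
Qed.

Lemma eD_eq0 k j : (k < j < n)%N -> (e k.+1 + e j.+1 == 0 :> 'rV[F]_n) = false.
Proof.
case/andP=> kj jn; have kn := ltn_trans kj jn.
apply/negbTE/eqP => /matrixP/(_ 0 (Ordinal kn)) /eqP.
by rewrite !mxE eqxx eqSS (ltn_eqF kj) addr0 oner_eq0.
Qed.

End ModelSignature.

Definition entry_signature (t : entry) : nat * nat * nat * nat :=
  match t with
  | N_1_1 => (1, 0, 1, 0) | E_1_2 => (1, 1, 0, 1)
  | N_2_1 => (2, 0, 2, 0) | N_2_2 => (2, 1, 1, 0)
  | E_2_3 => (2, 1, 1, 1) | E_2_4 => (2, 2, 0, 2)
  | N_3_1 => (3, 0, 3, 0) | N_3_2 => (3, 1, 2, 0) | N_3_3 => (3, 1, 1, 0)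
  | E_3_4 => (3, 1, 2, 1) | E_3_5 => (3, 2, 1, 1) | E_3_6 => (3, 2, 1, 2)
  | E_3_7 => (3, 3, 0, 3)
  | N_4_1 => (4, 0, 4, 0) | N_4_2 => (4, 1, 3, 0) | N_4_3 => (4, 1, 2, 0)
  | N_4_4 => (4, 2, 2, 0) | N_4_5 => (4, 1, 1, 0) | N_4_6 => (4, 2, 1, 0)
  | E_4_7 => (4, 1, 3, 1) | E_4_8 => (4, 2, 2, 1) | E_4_9 => (4, 2, 1, 1)
  | E_4_10 => (4, 2, 2, 2) | E_4_11 => (4, 3, 1, 2) | E_4_12 => (4, 3, 1, 3)
  | E_4_13 => (4, 4, 0, 4)
  end%N.

Lemma entry_signature_inj : injective entry_signature.
Proof. by case; case. Qed.

Ltac compute_dim :=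
  rewrite ?(scaler0, oppr0, addr0, add0r, addrN);
  repeat first
    [ rewrite dim_span0 | rewrite dim_spanZ | rewrite dim_spanN
    | rewrite dim_span_e; [|by []|by move=> ?; rewrite /= ?mxE /= ?mulr0 ?oppr0 ?eqxx]
    | rewrite dim_span_eD; [|by []|by move=> ?; rewrite /= ?mxE /= ?mulr0 ?oppr0 ?eqxx] ];
  by rewrite span_nil dimv0.

Ltac model_signature :=
  let m := fresh "m" in let mE := fresh "mE" in let me := fresh "me" in
  apply: iso_model_signature => m mE me; rewrite /square_signature /=;
  congr (_, _, _, _);
  [ compute_dim
  | by rewrite ?(eqxx, scaler_eq0, oppr_eq0, e_eq0, eD_eq0) //= ?orbF;
    repeat match goal with h : is_true (_ != 0) |- _ => rewrite (negPf h); clear h end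
 
  | rewrite ?mE ?me //=; compute_dim ].

Lemma belongs_signature (F : fieldType) (E : vectType F)
    (mul : {bilinear E -> E -> E}) (t : entry) :
  belongs_to mul t ->
  exists2 l, natural_basis mul l & signature mul l = entry_signature t.
Proof.
case: t => /=; do ?[model_signature]; try by case=> a a0; model_signature.
by case=> a [b [a0 b0]]; model_signature.
Qed.

Theorem proposition4p3p1 (F : fieldType) (E : vectType F)
    (mul : {bilinear E -> E -> E})
    (charF : 2%N \notin [pchar F])
    (dimE : (1 <= \dim {:E} <= 4)%N)
    (evoE : evolution_algebra mul)
    (paE : power_associative mul) :
  exists! t : entry, belongs_to mul t.
Proof.
have two_neq0 : 2%:R != 0 :> F by move: charF; rewrite inE.
have [b bb ob] := evoE; have nb : natural_basis mul b.
  split=> // x y /tnthP[i ->] /tnthP[j ->] nij; apply: ob.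
  by apply: contraNneq nij => ->.
have mulC := natural_mulC nb.
have gen_sq x : in_generated mul x (mul x x).
  by move=> U mulU xU; exact: mulU.
have power4 x : mul (mul x x) (mul x x) = mul x (mul x (mul x x)).
  by apply: (paE x) => //; apply: gen_sq.
have power5 x : mul (mul x (mul x x)) (mul x x) = mul x (mul (mul x x) (mul x x)).
  by apply: (paE x) => //; apply: gen_sq.
have [t bt] : exists t, belongs_to mul t.
  by apply: (belongs_exists two_neq0 mulC power4 power5 nb); rewrite size_tuple.
exists t; split=> // t' bt'; apply: entry_signature_inj.
have [[l nl <-] [l' nl' <-]] := (belongs_signature bt, belongs_signature bt').
exact: signature_unique.
Qed.
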